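(* A functional $Z:\mathrm{Conv}_{\mathrm{ld}}(\mathbb{R})\to\mathbb{R}$ is a $\tau$-continuous, translation invariant and dually epi-translation invariant valuation if and only if there are constants $c_0,c_1\in\mathbb{R}$ such that $$Z(u)=c_0+c_1V_1(\mathrm{dom}\,u)$$ for every $u\in\mathrm{Conv}_{\mathrm{ld}}(\mathbb{R})$.
   Context: For $u:\mathbb{R}\to(-\infty,+\infty]$ let $\mathrm{dom}\,u=\{x: u(x)<+\infty\}$. $\mathrm{Conv}(\mathbb{R})$ is the set of convex, lower semicontinuous functions $u:\mathbb{R}\to(-\infty,+\infty]$ with $u\not\equiv+\infty$. $\mathrm{Conv}_{\mathrm{ld}}(\mathbb{R})$ is the set of $u\in\mathrm{Conv}(\mathbb{R})$ such that $\mathrm{dom}\,u$ is compact and $u$ is Lipschitz on the interior of $\mathrm{dom}\,u$ (there is $L_u>0$ with $|u(x)-u(y)|\le L_u|x-y|$ for all $x,y$ in the interior of $\mathrm{dom}\,u$; this is no condition if the interior is empty). $\tau$-convergence: for $u_k,u\in\mathrm{Conv}_{\mathrm{ld}}(\mathbb{R})$, $u_k\xrightarrow{\tau}u$ means: (i) for every $x$ and every sequence $x_k\to x$, $u(x)\le\liminf_{k\to\infty}u_k(x_k)$; (ii) for every $x$ there is a sequence $x_k\to x$ with $u(x)=\lim_{k\to\infty}u_k(x_k)$; (iii) the Lipschitz constants of $u_k$ on the interiors of their domains are bounded by some $M>0$ independent of $k$. A functional $Z:\mathrm{Conv}_{\mathrm{ld}}(\mathbb{R})\to\mathbb{R}$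 is: a valuation if $Z(u\wedge v)+Z(u\vee v)=Z(u)+Z(v)$ whenever $u,v,u\wedge v,u\vee v\in\mathrm{Conv}_{\mathrm{ld}}(\mathbb{R})$, where $\wedge,\vee$ are pointwise minimum and maximum; $\tau$-continuous if $Z(u_k)\to Z(u)$ whenever $u_k\xrightarrow{\tau}u$; translation invariant if $Z(u\circ\tau)=Z(u)$ for all $u$ and all translations $\tau$ of $\mathbb{R}$; dually epi-translation invariant if $Z(u+l)=Z(u)$ for all $u$ and all linear $l:\mathbb{R}\to\mathbb{R}$ and $Z(u+c)=Z(u)$ for all $u$ and all constants $c\in\mathbb{R}$. $V_1$ denotes length. *)

(* Defs.v *)
From HB Require Import structures.
From mathcomp Require Import all_boot all_order all_algebra.
From mathcomp Require Import all_classical all_reals all_analysis.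
From mathcomp Require Import lra ring.

Set Implicit Arguments.
Unset Strict Implicit.
Unset Printing Implicit Defensive.

Import Order.TTheory GRing.Theory Num.Theory.
Import numFieldNormedType.Exports.

Local Open Scope classical_set_scope.
Local Open Scope ring_scope.

Definition dom (R : realType) (u : R -> \bar R) : set R :=
  [set x | (u x < +oo)%E].

(* Since 0 * +oo = 0 in \bar R, the cases t = 0 and t = 1 are trivially true. *)
Definition convex_efun (R : realType) (u : R -> \bar R) : Prop :=
  forall (x y t : R), 0 <= t <= 1 ->
    (u (t * x + (1 - t) * y)%R <= t%:E * u x + (1 - t)%:E * u y)%E.

Definition is_conv (R : realType) (u : R -> \bar R) : Prop :=
  [/\ forall x, (-oo < u x)%E,
      convex_efun u,
      lower_semicontinuous u &
      dom u !=set0].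

(* u is finite on dom u, so fine loses nothing there. *)
Definition lipschitz_int_dom (R : realType) (L : R) (u : R -> \bar R) : Prop :=
  L.-lipschitz_(interior (dom u)) (fun x => fine (u x)).

Definition is_conv_ld (R : realType) (u : R -> \bar R) : Prop :=
  [/\ is_conv u,
      compact (dom u) &
      exists2 L : R, 0 < L & lipschitz_int_dom L u].

Record conv_ld (R : realType) := ConvLd {
  conv_ld_fun :> R -> \bar R ;
  conv_ldP : is_conv_ld conv_ld_fun }.

Definition tau_cvg (R : realType) (u_ : nat -> conv_ld R) (u : conv_ld R) :
    Prop :=
  [/\ forall (x : R) (x_ : nat -> R), x_ @ \oo --> x ->
        (u x <= limn_einf (fun k => u_ k (x_ k)))%E,
      forall x : R, exists2 x_ : nat -> R, x_ @ \oo --> x &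
        (fun k => u_ k (x_ k)) @ \oo --> u x &
      exists2 M : R, 0 < M & forall k, lipschitz_int_dom M (u_ k)].

Section closure.
Context {R : realType}.
Implicit Types (u : conv_ld R) (a c : R).

Lemma translate_subproof u a : is_conv_ld (fun x => u (x + a)).
Proof.
have [[uNy ucvx ulsc [x0 ux0]] ucpt [L L0 uL]] := conv_ldP u.
have domE : dom (fun x => u (x + a)) = shift (- a) @` dom u.
  apply/seteqP; split => [x ux|_ [x ux <-]].
    by exists (x + a) => //=; rewrite addrK.
  by rewrite /dom /= subrK.
split; last 2 first.
- rewrite domE; apply: continuous_compact => //.
  by apply: continuous_subspaceT => x; apply: cvgD => //; exact: cvg_cst.
- exists L => // -[x y] [/= ix iy].
  have intD z : interior (dom (fun x => u (x + a))) z ->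
      interior (dom u) (z + a).
    move=> iz; suff : \forall w \near z + a, dom u w by [].
    rewrite (near_shift z) /=.
    apply: filterS iz => w; rewrite /dom /=.
    by rewrite (_ : w + (z + a - z) = w + a)//; ring.
  have := uL (x + a, y + a); rewrite /= opprD addrACA subrr addr0; apply.
  by split; exact: intD.
split => //.
- move=> x y t t01 /=.
  have -> : t * x + (1 - t) * y + a = t * (x + a) + (1 - t) * (y + a) by ring.
  exact: ucvx.
- move=> x b /ulsc[V nV uV].
  exists (shift a @^-1` V) => [|y /= /uV //].
  have : (fun y => y + a) @ x --> x + a by apply: cvgD => //; exact: cvg_cst.
  exact.
- by exists (x0 - a); rewrite /dom /= subrK.
Qed.

Lemma add_affine_subproof u m c :
  is_conv_ld (fun x => (u x + (m * x + c)%:E)%E).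
Proof.
have [[uNy ucvx ulsc [x0 ux0]] ucpt [L L0 uL]] := conv_ldP u.
have domE : dom (fun x => u x + (m * x + c)%:E)%E = dom u.
  by apply/seteqP; split => x; rewrite /dom /=; case: (u x) => //= r _; exact: ltry.
have ufin x : dom u x -> u x \is a fin_num.
  by move=> ux; rewrite fin_numE gt_eqF//= lt_eqF.
split; rewrite ?domE //; last first.
  exists (L + `|m|); first by rewrite ltr_wpDr.
  rewrite /lipschitz_int_dom domE => -[x y] [/= ix iy].
  rewrite !fineD ?ufin //; try exact: interior_subset.
  rewrite /= (_ : _ - _ = (fine (u x) - fine (u y)) + m * (x - y)); last by ring.
  rewrite (le_trans (ler_normD _ _))// normrM mulrDl lerD2r.
  exact: (uL (x, y)).
split => //; last by rewrite domE; exists x0.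
- by move=> x; move: (uNy x); case: (u x) => //= r _; exact: ltNyr.
- move=> x y t /[dup] t01 /andP[t0 t1] /=.
  have := ucvx x y t t01.
  rewrite !muleDr ?fin_num_adde_defl // addeACA -!EFinM -EFinD.
  rewrite (_ : m * (t * x + (1 - t) * y) + c =
    t * (m * x + c) + (1 - t) * (m * y + c)); last by ring.
  by move=> ?; rewrite leeD2r.
- move=> x b bux.
  have [d1 du db] : exists2 d : R, (d%:E < u x)%E & b - (m * x + c) < d.
    move: bux (uNy x); case: (u x) => [r||//] /=.
      rewrite -EFinD lte_fin => h _; exists ((r + (b - (m * x + c))) / 2).
        by rewrite lte_fin; lra.
      by lra.
    by move=> _ _; exists (b - (m * x + c) + 1); rewrite ?ltry// ltrDl.
  have [V nV uV] := ulsc _ _ du.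
  exists (V `&` [set y | b - d1 < m * y + c]).
    apply: filterI => //.
    have mc : (fun y => m * y + c) @ x --> m * x + c.
      by apply: cvgD; [exact: mulrl_continuous|exact: cvg_cst].
    apply: (cvgr_gt _ mc); lra.
  move=> y [/uV Vy /= by_]; move: Vy; case: (u y) => [r||//]; last first.
    by move=> _; rewrite addye// ltry.
  rewrite -EFinD !lte_fin; move: by_; move: (m * y : R) => my; lra.
Qed.

Lemma add_linear_subproof u (l : {linear R^o -> R^o}) :
  is_conv_ld (fun x => (u x + (l x)%:E)%E).
Proof.
rewrite (_ : (fun x => _) = (fun x => u x + (l 1 * x + 0)%:E)%E).
  exact: add_affine_subproof.
apply/funext => x; congr (_ + _%:E)%E.
by rewrite addr0 mulrC -[LHS]/(l x) -[in LHS](mulr1 x) -linearZ.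
Qed.

Lemma add_const_subproof u c : is_conv_ld (fun x => (u x + c%:E)%E).
Proof.
rewrite (_ : (fun x => _) = (fun x => u x + (0 * x + c)%:E)%E).
  exact: add_affine_subproof.
by apply/funext => x; rewrite mul0r add0r.
Qed.

Definition translate u a : conv_ld R := ConvLd (translate_subproof u a).
Definition add_linear u (l : {linear R^o -> R^o}) : conv_ld R :=
  ConvLd (add_linear_subproof u l).
Definition add_const u c : conv_ld R := ConvLd (add_const_subproof u c).

End closure.

Section functionals.
Context {R : realType}.
Implicit Type Z : conv_ld R -> R.

(* i and s are the pointwise minimum and maximum of u and v; quantifying over
   them in conv_ld R expresses that both lie in the domain of Z. *)
Definition valuation Z : Prop := forall u v i s : conv_ld R,
  (forall x, i x = mine (u x) (v x)) -> (forall x, s x = maxe (u x) (v x)) ->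
  Z i + Z s = Z u + Z v.

Definition tau_continuous Z : Prop :=
  forall (u_ : nat -> conv_ld R) (u : conv_ld R),
    tau_cvg u_ u -> (fun k => Z (u_ k)) @ \oo --> Z u.

Definition translation_invariant Z : Prop :=
  forall (u : conv_ld R) (a : R), Z (translate u a) = Z u.

Definition dually_epi_translation_invariant Z : Prop :=
  (forall (u : conv_ld R) (l : {linear R^o -> R^o}), Z (add_linear u l) = Z u)
  /\ (forall (u : conv_ld R) (c : R), Z (add_const u c) = Z u).

End functionals.

(* dom u is compact for u in conv_ld R, so its Lebesgue measure is finite. *)
Definition V1 (R : realType) (A : set R) : R :=
  fine ((@lebesgue_measure R) A).

(* Main.v *)
Require Import Defs.
From mathcomp Require Import all_boot all_order all_algebra.
From mathcomp Require Import all_classical all_reals all_analysis.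
From mathcomp Require Import lra ring.
(* If [a, b] is cut at p, then u + I_[a,b] is the minimum of u + I_[a,p] and
   u + I_[p,b]. Their maximum is u(p) + I_{p}, on which Z takes a constant value
   c0, so [p, q] |-> Z(u + I_[p,q]) - c0 is additive. For affine u the
   invariances make it depend on q - p only, and continuity as q - p -> 0 makes
   it linear, with a slope c1 not depending on u. Hence Z(u) = c0 + c1 V_1(dom u)
   for piecewise affine u, and the general case follows since chord interpolants
   of u on finer and finer meshes of dom u share its Lipschitz constant and
   tau-converge to it.
   Conversely, if the domains of u_k reached beyond dom u in the limit, the
   uniform Lipschitz bound would keep u_k bounded at a point where u = +oo,
   against the liminf inequality; so the lengths converge. *)

Set Implicit Arguments.
Unset Strict Implicit.
Unset Printing Implicit Defensive.
Import Order.TTheory GRing.Theory Num.Theory.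
Import numFieldNormedType.Exports.

Local Open Scope classical_set_scope.
Local Open Scope ring_scope.

(** * Lower limits of extended real sequences, tested against finite levels *)

Section limn_einf.
Context {R : realType}.
Implicit Types (v : (\bar R)^nat) (l : \bar R) (c : R).

Lemma limn_einf_supE v : limn_einf v = ereal_sup (range (einfs v)).
Proof. by rewrite limn_einf_lim; apply/cvg_lim => //; exact: cvg_einfs_sup. Qed.

(** Testing only real levels strictly below [l] covers finite and infinite [l] at once, and it
    matches the form in which lower semicontinuity supplies its thresholds. *)
Lemma le_limn_einf v l :
  (forall c, (c%:E < l)%E -> \forall k \near \oo, (c%:E <= v k)%E) ->
  (l <= limn_einf v)%E.
Proof.
move=> vl.
have ge c : (c%:E < l)%E -> (c%:E <= limn_einf v)%E.
  move=> /vl[N _ Nv]; rewrite limn_einf_supE.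
  apply: le_trans (ereal_sup_ubound _); last by exists N.
  by apply: le_ereal_inf_tmp => _ [k /= Nk <-]; exact: Nv.
case: l vl ge => [r| |] _ ge; last by rewrite leNye.
- apply/lee_addgt0Pr => e e0; rewrite -leeBlDr//; apply: ge.
  by rewrite lte_fin ltrBlDr ltrDl.
- by rewrite leye_eq; apply/eqP/eqyP => c _; apply: ge; rewrite ltry.
Qed.

Lemma limn_einf_gt v c : (c%:E < limn_einf v)%E ->
  \forall k \near \oo, (c%:E < v k)%E.
Proof.
rewrite limn_einf_supE => /ereal_sup_gt[_ [N _ <-]] cN.
exists N => // k /= Nk; apply: (lt_le_trans cN).
by apply: ereal_inf_lbound; exists k.
Qed.

End limn_einf.

(** * Convexity, shape of the domain, and Lipschitz bounds up to its boundary *)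

Section conv_ld_basics.
Context {R : realType}.
Implicit Types u v : conv_ld R.

(** The membership proofs are identified by proof irrelevance; values of a functional can then be
    compared by comparing its arguments pointwise. *)
Lemma conv_ld_ext u v : (forall x, u x = v x) -> u = v.
Proof.
case: u v => [u Pu] [v Pv] /= /funext uv; case: _ / uv in Pv *.
by congr ConvLd; exact: Prop_irrelevance.
Qed.

Lemma conv_ld_fineK u x : dom u x -> (fine (u x))%:E = u x.
Proof.
have [[uNy _ _ _] _ _] := conv_ldP u => ux.
by rewrite fineK// fin_numE gt_eqF//= lt_eqF.
Qed.

Lemma conv_ld_fine_conv u x y t : 0 <= t <= 1 -> dom u x -> dom u y ->
  dom u (t * x + (1 - t) * y) /\
  fine (u (t * x + (1 - t) * y)) <= t * fine (u x) + (1 - t) * fine (u y).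
Proof.
have [[_ ucvx _ _] _ _] := conv_ldP u => t01 ux uy.
have := ucvx x y t t01.
rewrite -(conv_ld_fineK ux) -(conv_ld_fineK uy) -!EFinM -EFinD => h.
have ud : dom u (t * x + (1 - t) * y) by exact: le_lt_trans h (ltry _).
by split => //; rewrite -lee_fin (conv_ld_fineK ud).
Qed.

(** Convexity at the weight t = (r - q) / (r - p), with the denominator cleared so that [p = r] is
    allowed and linear arithmetic applies. *)
Lemma conv_ld_chord u p q r : p <= q <= r -> dom u p -> dom u r ->
  dom u q /\
  (r - p) * fine (u q) <= (r - q) * fine (u p) + (q - p) * fine (u r).
Proof.
move=> /andP[pq qr] up ur; have [pr|pr] := eqVneq p r.
  have -> : q = p by apply/eqP; rewrite eq_le pq pr qr.
  by split => //; rewrite -pr !subrr !mul0r addr0.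
have rp : 0 < r - p by rewrite subr_gt0 lt_neqAle pr (le_trans pq).
pose t := (r - q) / (r - p).
have t01 : 0 <= t <= 1.
  by rewrite divr_ge0 ?subr_ge0 ?(le_trans pq)//= ler_pdivrMr// mul1r lerB.
have qE : t * p + (1 - t) * r = q.
  by rewrite /t; field; rewrite gt_eqF.
have [] := conv_ld_fine_conv t01 up ur; rewrite qE => uq h; split => //.
have -> : (r - q) * fine (u p) + (q - p) * fine (u r) =
  (r - p) * (t * fine (u p) + (1 - t) * fine (u r)).
  by rewrite /t; field; rewrite gt_eqF.
by rewrite ler_pM2l.
Qed.

(** Compactness provides a least and a greatest point of the domain, and convexity fills in
    everything between them. *)
Lemma dom_itv u : exists a b, a <= b /\ dom u = `[a, b]%classic.
Proof.
have [[_ _ _ u0] ucpt _] := conv_ldP u.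
have cid : {within dom u, continuous (@idfun R)}.
  by apply: continuous_subspaceT => x; exact: cvg_id.
have [b bu ub] := compact_EVT_max u0 ucpt cid.
have [a au ua] := compact_EVT_min u0 ucpt cid.
exists a, b; split; first exact: ub.
apply/seteqP; split => x /=.
  by move=> xu; rewrite in_itv/= ua ?ub ?inE.
by rewrite in_itv/= => xab;
  have [] := conv_ld_chord xab (set_mem au) (set_mem bu).
Qed.

(* At an endpoint of the domain, midpoint convexity bounds u from below and lower
   semicontinuity bounds it from above. *)
Lemma dom_lipschitz u L : 0 <= L -> lipschitz_int_dom L u ->
  forall x y, dom u x -> dom u y ->
    `|fine (u x) - fine (u y)| <= L * `|x - y|.
Proof.
move=> L0 uL; have [a [b [ab domE]]] := dom_itv u.
have [[_ _ ulsc _] _ _] := conv_ldP u.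
have intE x : a < x < b -> interior (dom u) x.
  by rewrite domE interior_itv_bnd /= in_itv.
have intL x y : a < x < b -> a < y < b ->
    `|fine (u x) - fine (u y)| <= L * `|x - y|.
  by move=> /intE ix /intE iy; exact: (uL (x, y)).
have domP x : dom u x <-> a <= x <= b by rewrite domE /= in_itv.
have mid x y : dom u x -> a < y < b ->
    `|fine (u x) - fine (u y)| <= L * `|x - y|.
  move=> ux /[dup] yab /andP[ay yb].
  have uy : dom u y by apply/domP; rewrite !ltW.
  have /domP/andP[ax xb] := ux.
  rewrite ler_distl; apply/andP; split.
    have t01 : 0 <= (2^-1 : R) <= 1 by lra.
    have [_] := conv_ld_fine_conv t01 ux uy.
    set z := _ + _ * y => uz.
    have zab : a < z < b by rewrite /z; lra.
    have := intL _ _ yab zab.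
    have -> : y - z = 2^-1 * (y - x) by rewrite /z; field.
    rewrite normrM (distrC y) (ger0_norm (_ : 0 <= 2^-1)) ?invr_ge0// mulrCA.
    by rewrite ler_distl => /andP[h1 h2]; lra.
  rewrite leNgt; apply/negP => lt_ux.
  have : ((fine (u y) + L * `|x - y|)%:E < u x)%E.
    by rewrite -(conv_ld_fineK ux) lte_fin.
  move=> /ulsc[V /nbhs_ballP[e /= e0 eV] uV].
  have d0 : 0 < `|x - y| + 1 by rewrite ltr_wpDl.
  (* A weight so small that moving from [x] towards [y] by this proportion stays in [V]; the added 1
     in the denominator covers the case [x = y]. *)
  have [t /andP[t0 t1] te] : exists2 t, 0 < t <= 1 & t * `|x - y| < e.
    exists (Num.min 1 (e / (`|x - y| + 1))).
      by rewrite lt_min ltr01 divr_gt0//= ge_min lexx.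
    apply: (@le_lt_trans _ _ (e / (`|x - y| + 1) * `|x - y|)).
      by rewrite ler_wpM2r// ge_min lexx orbT.
    by rewrite mulrAC ltr_pdivrMr// ltr_pM2l// ltrDl.
  pose z := t * y + (1 - t) * x.
  have zab : a < z < b by rewrite /z; apply/andP; split; nra.
  have Vz : V z.
    apply: eV; rewrite /ball /=.
    have -> : x - z = t * (x - y) by rewrite /z; ring.
    by rewrite normrM gtr0_norm.
  have uz : dom u z by apply/domP; move: zab => /andP[*]; rewrite !ltW.
  have := uV _ Vz; rewrite -(conv_ld_fineK uz) lte_fin.
  have := intL _ _ zab yab.
  have -> : z - y = (1 - t) * (x - y) by rewrite /z; ring.
  rewrite normrM (ger0_norm (_ : 0 <= 1 - t)) ?subr_ge0//.
  rewrite ler_distl => /andP[_ h].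
  have : 0 <= L * `|x - y| by rewrite mulr_ge0.
  by rewrite mulrCA in h; move: (L * _) h => d; nra.
(* The midpoint of two distinct points is interior even if both are endpoints of the domain. The
   bounds on the two halves add up to exactly [L * (y - x)]. *)
have wlog_lt x y : x < y -> dom u x -> dom u y ->
    `|fine (u x) - fine (u y)| <= L * `|x - y|.
  move=> xy ux uy.
  have /domP/andP[ax xb] := ux; have /domP/andP[ay yb] := uy.
  have mab : a < (x + y) / 2 < b by lra.
  have hx := mid _ _ ux mab; have hy := mid _ _ uy mab.
  move: hx hy; set m := (x + y) / 2.
  rewrite (distrC x y) (gtr0_norm (_ : 0 < y - x)) ?subr_gt0//.
  rewrite (distrC x m) (gtr0_norm (_ : 0 < m - x)) ?(gtr0_norm (_ : 0 < y - m));
    try by rewrite /m; lra.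
  have -> : m - x = (y - x) / 2 by rewrite /m; field.
  have -> : y - m = (y - x) / 2 by rewrite /m; field.
  by rewrite mulrA !ler_distl => /andP[? ?] /andP[? ?]; lra.
move=> x y ux uy; have [xy|yx|->] := ltgtP x y.
- exact: wlog_lt.
- by rewrite distrC (distrC x); exact: wlog_lt.
- by rewrite !subrr !normr0 mulr0.
Qed.
End conv_ld_basics.

(** * The length of the domain as an invariant, tau-continuous valuation *)

Section length_of_domain.
Context {R : realType}.
Implicit Types u v : conv_ld R.

Lemma V1_itv (a b : R) : a <= b -> V1 `[a, b]%classic = b - a.
Proof.
rewrite le_eqVlt => /predU1P[->|ab]; rewrite /V1 lebesgue_measure_itv/=.
  by rewrite ltxx subrr.
by rewrite lte_fin ab.
Qed.

(** The minimum has the union of the domains as its domain and the maximum the intersection, so this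
    is inclusion-exclusion for Lebesgue measure. *)
Lemma V1_dom_valuation : valuation (fun u : conv_ld R => V1 (dom u)).
Proof.
move=> u v i s iE sE.
have -> : dom i = dom u `|` dom v.
  by apply/seteqP; split => x; rewrite /dom /= iE gt_min => /orP.
have -> : dom s = dom u `&` dom v.
  by apply/seteqP; split => x; rewrite /dom /= sE gt_max => /andP.
have mfin (w : conv_ld R) :
    measurable (dom w) /\ lebesgue_measure (dom w) \is a fin_num.
  have [a [b [_ ->]]] := dom_itv w; split; first exact: measurable_itv.
  by rewrite lebesgue_measure_itv/=; case: ifP.
have [mu fu] := mfin u; have [mv fv] := mfin v.
have fI : lebesgue_measure (dom u `&` dom v) \is a fin_num.
  rewrite ge0_fin_numE//; apply: (@le_lt_trans _ _ (lebesgue_measure (dom u))).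
    by apply: le_measure; rewrite ?inE//; exact: measurableI.
  by rewrite -ge0_fin_numE.
rewrite /V1 measureUfinl//; last by rewrite -ge0_fin_numE.
by rewrite fineB ?fin_numD ?fu// fineD// subrK.
Qed.

Lemma V1_dom_translate u c : V1 (dom (translate u c)) = V1 (dom u).
Proof.
have [a [b [ab domE]]] := dom_itv u.
have -> : dom (translate u c) = `[a - c, b - c]%classic.
  apply/seteqP; split => x; rewrite /= in_itv/=.
    move=> xu; have : dom u (x + c) by [].
    by rewrite domE /= in_itv/=; lra.
  by move=> xab; suff : dom u (x + c) by []; rewrite domE/= in_itv/=; lra.
by rewrite domE !V1_itv//; lra.
Qed.

Lemma dom_add_fin u (f : R -> R) : dom (fun x => u x + (f x)%:E)%E = dom u.
Proof.
apply/seteqP; split => x; rewrite /dom /=; case: (u x) => //= r _;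
  exact: ltry.
Qed.

(** A recovery sequence at a point where [u] is finite must eventually run inside the domains, with
    values bounded from above. *)
Lemma tau_cvg_dom (u_ : nat -> conv_ld R) u x :
  tau_cvg u_ u -> dom u x ->
  exists2 x_ : nat -> R, x_ @ \oo --> x & \forall k \near \oo,
    dom (u_ k) (x_ k) /\ fine (u_ k (x_ k)) < fine (u x) + 1.
Proof.
move=> [_ + _] ux => /(_ x)[x_ x_x ux_]; exists x_ => //.
have : (u x < (fine (u x) + 1)%:E)%E.
  by rewrite -{1}(conv_ld_fineK ux) lte_fin ltrDl.
move=> lt_ux; near=> k.
have h : (u_ k (x_ k) < (fine (u x) + 1)%:E)%E.
  near: k; apply: (ux_ [set y | (y < (fine (u x) + 1)%:E)%E]).
    apply: open_nbhs_nbhs; split => //.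
    exact: open_ereal_lt_ereal.
have uk : dom (u_ k) (x_ k) by exact: lt_trans h (ltry _).
by split => //; rewrite -lte_fin (conv_ld_fineK uk).
Unshelve. all: by end_near. Qed.

Lemma tau_cvg_notin_dom (u_ : nat -> conv_ld R) u y :
  tau_cvg u_ u -> ~ dom u y ->
  \forall k \near \oo, ~ dom (u_ k) y.
Proof.
move=> uu ndy; have [[_ _ _ [x ux]] _ _] := conv_ldP u.
have [x_ x_x ux_] := tau_cvg_dom uu ux.
have [lsc _ [M M0 uM]] := uu.
(* The bound that [dom (u_ k) y] would force on [u_ k y]: the value at [x_ k] is below
   [fine (u x) + 1], and [x_ k] is eventually within 1 of [x]. *)
pose C := fine (u x) + 1 + M * (`|x - y| + 1).
have uyC : (C%:E < limn_einf (fun k => u_ k y))%E.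
  apply: lt_le_trans (lsc y (fun=> y) (cvg_cst _)).
  by move/negP: ndy; rewrite -leNgt leye_eq => /eqP ->; exact: ltry.
near=> k => uky.
have [ukx ltx] : dom (u_ k) (x_ k) /\ fine (u_ k (x_ k)) < fine (u x) + 1.
  by near: k.
have : (C%:E < u_ k y)%E by near: k; exact: limn_einf_gt.
have xk1 : `|x - x_ k| < 1 by near: k; exact: cvgr_dist_lt.
rewrite -(conv_ld_fineK uky) lte_fin.
have := dom_lipschitz (ltW M0) (uM k) uky ukx.
rewrite ler_distl => /andP[_ h1].
have : `|y - x_ k| <= `|x - y| + 1.
  by rewrite -(subrKA x) (distrC x y) (le_trans (ler_normD _ _))// lerD2l ltW.
rewrite -(ler_pM2l M0) /C; move: h1 ltx; lra.
Unshelve. all: by end_near. Qed.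

(** Recovery sequences at [a] and [b] prevent the endpoints of the domains from moving inwards in
    the limit; the excluded points [a - d] and [b + d] prevent them from moving outwards. *)
Lemma V1_dom_tau_continuous : tau_continuous (fun u : conv_ld R => V1 (dom u)).
Proof.
move=> u_ u uu; have [a [b [ab domE]]] := dom_itv u.
have domP x : dom u x <-> a <= x <= b by rewrite domE /= in_itv.
have ua : dom u a by apply/domP; rewrite lexx.
have ub : dom u b by apply/domP; rewrite lexx ab.
have [a_ a_a ua_] := tau_cvg_dom uu ua.
have [b_ b_b ub_] := tau_cvg_dom uu ub.
apply/cvgrPdist_lt => e e0; pose d := e / 2.
have d0 : 0 < d by rewrite divr_gt0.
have uNa : ~ dom u (a - d) by move/domP; lra.
have uNb : ~ dom u (b + d) by move/domP; lra.
near=> k.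
have [ka _] : dom (u_ k) (a_ k) /\ fine (u_ k (a_ k)) < fine (u a) + 1.
  by near: k.
have [kb _] : dom (u_ k) (b_ k) /\ fine (u_ k (b_ k)) < fine (u b) + 1.
  by near: k.
have kNa : ~ dom (u_ k) (a - d) by near: k; exact: tau_cvg_notin_dom uNa.
have kNb : ~ dom (u_ k) (b + d) by near: k; exact: tau_cvg_notin_dom uNb.
have : `|a - a_ k| < d by near: k; exact: cvgr_dist_lt.
have : `|b - b_ k| < d by near: k; exact: cvgr_dist_lt.
have [a' [b' [ab' domE']]] := dom_itv (u_ k).
move: ka kb kNa kNb; rewrite domE domE' !V1_itv// /= !in_itv/= => ka kb.
move=> /negP + /negP; rewrite !negb_and -!ltNge => /orP kNa /orP kNb.
rewrite !ltr_distl /d in kNa kNb * => ? ?.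
(* [a - d] cannot lie to the right of the domain, which contains [a_ k > a - d]; likewise for
   [b + d]. So each endpoint is off by less than [d], and the length by less than [2 * d = e]. *)
by case: kNa => ?; case: kNb => ?; lra.
Unshelve. all: by end_near. Qed.

End length_of_domain.

(** * Convex Lipschitz functions on the line, cut down to compact intervals *)

Section restriction_to_intervals.
Context {R : realType}.
Implicit Types (f : R -> R) (L a b c m p q x y : R).

(** The conditions are imposed on the whole line, so that one [f] restricts to every interval with
    the same constant. The Lipschitz bound is one-sided because [x] and [y] may be exchanged. *)
Definition convex_lipschitz L f :=
  [/\ 0 < L,
      forall x y t, 0 <= t <= 1 ->
        f (t * x + (1 - t) * y) <= t * f x + (1 - t) * f y &
      forall x y, f x <= f y + L * `|x - y|].

(** This is f + I_[a,b], with I the convex indicator function (0 on the set, [+oo] off it). *)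
Definition itv_fun f a b x : \bar R :=
  if a <= x <= b then (f x)%:E else +oo%E.

Lemma dom_itv_fun f a b : dom (itv_fun f a b) = `[a, b]%classic.
Proof.
apply/seteqP; split => x; rewrite /dom /itv_fun /= in_itv/=;
  by case: ifP; rewrite ?ltry ?ltxx.
Qed.

Lemma itv_fun_lipschitz L f a b : convex_lipschitz L f ->
  lipschitz_int_dom L (itv_fun f a b).
Proof.
move=> [L0 _ fL]; rewrite /lipschitz_int_dom dom_itv_fun => -[x y] [].
move=> /(@interior_subset R^o); rewrite /= in_itv/= => xab.
move=> /(@interior_subset R^o); rewrite /= in_itv/= => yab.
rewrite /itv_fun xab yab /= ler_distl lerBlDr fL andbT.
by rewrite -(opprB y x) normrN fL.
Qed.

Lemma itv_fun_conv_ld L f a b : convex_lipschitz L f -> a <= b ->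
  is_conv_ld (itv_fun f a b).
Proof.
move=> cf ab; have [L0 fcvx fL] := cf.
have Ny x : (-oo < itv_fun f a b x)%E.
  by rewrite /itv_fun; case: ifP; rewrite ?ltNyr.
split; last 2 first.
- by rewrite dom_itv_fun; exact: segment_compact.
- by exists L => //; exact: itv_fun_lipschitz.
split => //.
- move=> x y t /andP[].
  (* The weights 0 and 1 are split off because 0 times [+oo] is 0; for the others, an infinite value
     at [x] or [y] makes the right-hand side [+oo]. *)
  rewrite le_eqVlt => /predU1P[<- _|t0].
    by rewrite subr0 !mul0r !mul1r add0r mul0e mul1e add0e.
  rewrite le_eqVlt => /predU1P[->|t1].
    by rewrite subrr !mul0r !mul1r addr0 mul0e mul1e adde0.
  have s0 : 0 < 1 - t by rewrite subr_gt0.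
  have [xab|xab] := boolP (a <= x <= b); last first.
    rewrite [in X in (_ <= X + _)%E]/itv_fun (negbTE xab) gt0_muley ?lte_fin//.
    rewrite addye ?leey//.
    by move: (Ny y); case: (itv_fun f a b y) => //= _;
      rewrite gt0_muley ?lte_fin.
  have [yab|yab] := boolP (a <= y <= b); last first.
    rewrite [in X in (_ <= _ + X)%E]/itv_fun (negbTE yab) gt0_muley ?lte_fin//.
    by rewrite /itv_fun xab addey ?leey.
  rewrite /itv_fun xab yab ifT; first by rewrite lee_fin fcvx ?ltW.
  move: xab yab => /andP[ax xb] /andP[ay yb].
  by apply/andP; split; nra.
- move=> x c; rewrite {1}/itv_fun; case: ifPn => xab.
    rewrite lte_fin => cfx.
    (* Within this radius the [L]-Lipschitz function [f] drops by less than [f x - c]. *)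
    exists (ball x ((f x - c) / L)).
      by apply: nbhsx_ballx; rewrite divr_gt0// subr_gt0.
    move=> y; rewrite /ball/= ltr_pdivlMr// mulrC => h.
    rewrite /itv_fun; case: ifP => _; rewrite ?ltry// lte_fin.
    by have := fL x y; lra.
  move=> _; exists (~` `[a, b]%classic).
    apply: open_nbhs_nbhs; split; last by rewrite /= in_itv/=; exact/negP.
    by apply: closed_openC; exact: itv_closed.
  by move=> y /=; rewrite in_itv/= /itv_fun => /negP/negbTE ->; exact: ltry.
- by exists a; rewrite dom_itv_fun /= in_itv/= lexx.
Qed.

Definition restr L f (fL : convex_lipschitz L f) a b (ab : a <= b) :
    conv_ld R :=
  ConvLd (itv_fun_conv_ld fL ab).

Lemma eq_restr L f (fL : convex_lipschitz L f) L' g (gL : convex_lipschitz L' g)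
    a b (ab ab' : a <= b) :
  (forall x, a <= x <= b -> f x = g x) -> restr fL ab = restr gL ab'.
Proof.
by move=> fg; apply: conv_ld_ext => x /=; rewrite /itv_fun;
  case: ifP => // /fg ->.
Qed.

(** The difference of two affine functions is monotone, so it is compared with its value at [p] or
    at [q] according to which slope is larger. *)
Lemma affine_le_between m c m' c' p q x : p <= x <= q ->
  m * p + c <= m' * p + c' -> m * q + c <= m' * q + c' ->
  m * x + c <= m' * x + c'.
Proof.
move=> /andP[px xq] hp hq; have [mm|mm] := leP m m'.
  have : m * (x - p) <= m' * (x - p) by rewrite ler_wpM2r// subr_ge0.
  by lra.
have : m' * (q - x) <= m * (q - x) by rewrite ler_wpM2r ?subr_ge0// ltW.
by lra.
Qed.

Lemma convex_lipschitz_affine L m c : 0 < L -> `|m| <= L ->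
  convex_lipschitz L (fun x => m * x + c).
Proof.
move=> L0 mL; split => // [x y t _|x y]; first by lra.
have : m * (x - y) <= L * `|x - y|.
  by apply: (le_trans (ler_norm _)); rewrite normrM ler_wpM2r.
lra.
Qed.

(** Both conditions bound a value of [l i] by expressions increasing in other values of [l i], hence
    pass to the maximum. The default [l 0 x] is one of the maximands and changes nothing. *)
Lemma convex_lipschitz_bigmax n L (l : nat -> R -> R) :
  (forall i, (i <= n)%N -> convex_lipschitz L (l i)) ->
  convex_lipschitz L (fun x => \big[Num.max/l 0%N x]_(i < n.+1) l i x).
Proof.
move=> lL; have [L0 _ _] := lL 0%N (leq0n n).
have sup x (i : 'I_n.+1) : l i x <= \big[Num.max/l 0%N x]_(i < n.+1) l i x.
  exact: (le_bigmax _ (fun i : 'I_n.+1 => l i x)).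
have max_le x B : (forall i : 'I_n.+1, l i x <= B) ->
    \big[Num.max/l 0%N x]_(i < n.+1) l i x <= B.
  by move=> lB; apply: bigmax_le => // ; exact: (lB ord0).
split => // [x y t /[dup] t01 /andP[t0 t1]|x y]; apply: max_le => i.
  have [_ /(_ x y t t01) h _] := lL i (leq_ord i).
  by apply: (le_trans h); rewrite lerD// ler_wpM2l// subr_ge0.
have [_ _ /(_ x y) h] := lL i (leq_ord i).
by apply: (le_trans h); rewrite lerD2r.
Qed.

Lemma convex_lipschitz0 : convex_lipschitz 1 (fun _ : R => 0).
Proof. by split => // x y *; rewrite ?mulr0 ?addr0 ?add0r ?mul1r. Qed.

(** This turns tau-continuity of a functional into continuity at length 0. Away from 0 the functions
    are eventually [+oo] along any convergent sequence, and at 0 they all vanish. *)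
Lemma tau_cvg_shrinking_itv (r : nat -> R) : r @ \oo --> 0 ->
  tau_cvg (fun k => restr convex_lipschitz0 (normr_ge0 (r k)))
          (restr convex_lipschitz0 (normr_ge0 (0 : R))).
Proof.
move=> r0.
have out x (x_ : nat -> R) : x != 0 -> x_ @ \oo --> x ->
    \forall k \near \oo, itv_fun (fun=> 0) 0 `|r k| (x_ k) = +oo%E.
  move=> x0 x_x; have x20 : 0 < `|x| / 2 by rewrite divr_gt0// normr_gt0.
  near=> k; rewrite /itv_fun ifF//; apply/negP => /andP[x1 x2].
  have : `|x - x_ k| < `|x| / 2 by near: k; exact: cvgr_dist_lt.
  have : `|0 - r k| < `|x| / 2 by near: k; exact: cvgr_dist_lt.
  rewrite sub0r normrN => h1 h2.
  have := ler_normD (x - x_ k) (x_ k); rewrite subrK (ger0_norm x1).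
  by move: h1 h2 x2; lra.
have in0 (s : R) : itv_fun (fun=> 0) 0 `|s| 0 = 0%:E.
  by rewrite /itv_fun lexx normr_ge0.
split.
- move=> x x_ x_x; apply: le_limn_einf => c.
  have [->|x0] := eqVneq x 0; last first.
    by move=> _; near=> k; rewrite /= (near (out _ _ x0 x_x) k)// leey.
  rewrite [X in (_ < X)%E]in0 lte_fin => c0; apply: nearW => k /=.
  by rewrite /itv_fun; case: ifP => _; rewrite ?leey// lee_fin ltW.
- move=> x; exists (fun=> x); first exact: cvg_cst.
  have [->|x0] := eqVneq x 0.
    rewrite [X in _ --> X]in0 (_ : (fun k => _) = fun=> 0%:E).
      exact: cvg_cst.
    by apply/funext => k; exact: in0.
  rewrite [X in _ --> X](_ : _ = +oo%E); last first.
    by rewrite /= /itv_fun normr0 -eq_le eq_sym (negbTE x0).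
  apply: cvg_near_cst; near=> k; apply: (near (out _ _ x0 (cvg_cst x)) k) => //.
- by exists 1 => // k; apply: itv_fun_lipschitz; exact: convex_lipschitz0.
Unshelve. all: by end_near. Qed.

End restriction_to_intervals.

(** * Values of an invariant valuation on affine functions over intervals *)

Section functional_on_affine_functions.
Context {R : realType}.
Context (Z : conv_ld R -> R).
Context (Zc : tau_continuous Z) (Zt : translation_invariant Z).
Context (Zd : dually_epi_translation_invariant Z) (Zv : valuation Z).
Implicit Types (f : R -> R) (L a b m c x y t : R).

(* Only s >= 0 is meant; the absolute value makes z total. *)
Let z (s : R) := Z (restr (@convex_lipschitz0 R) (normr_ge0 s)).

Lemma Z_restr0 a b (ab : a <= b) :
  Z (restr (@convex_lipschitz0 R) ab) = z (b - a).
Proof.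
rewrite /z -[RHS](Zt _ (- a)); congr Z; apply: conv_ld_ext => x /=.
by rewrite /itv_fun (ger0_norm (_ : 0 <= b - a)) ?subr_ge0// lerD2r.
Qed.

Lemma Z_restr_affine L m c (fL : convex_lipschitz L (fun x => m * x + c)) a b
    (ab : a <= b) :
  Z (restr fL ab) = z (b - a).
Proof.
rewrite -(Z_restr0 ab) -[RHS](Zd.1 _ ( *:%R m : {linear R^o -> R^o})).
rewrite -[RHS](Zd.2 _ c).
congr Z; apply: conv_ld_ext => x /=; rewrite /itv_fun; case: ifP => _ //.
by rewrite -!EFinD add0r.
Qed.

Lemma Z_split L f (fL : convex_lipschitz L f) a p b (ap : a <= p)
    (pb : p <= b) :
  Z (restr fL (le_trans ap pb)) + Z (restr fL (lexx p)) =
  Z (restr fL ap) + Z (restr fL pb).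
Proof.
apply: Zv => x /=; rewrite /itv_fun.
  have [xp|xp|->] := ltgtP x p; rewrite ?andbT ?andbF ?lexx ?ap ?pb ?minxx//.
  - by rewrite (le_trans (ltW xp) pb) !andbT;
      case: (a <= x); rewrite ?miney ?minye.
  - by rewrite (le_trans ap (ltW xp)) /=; case: (x <= b); rewrite ?miney ?minye.
have [xp|xp|->] := ltgtP x p; rewrite ?andbT ?andbF ?lexx ?ap ?pb ?maxxx//.
- by case: (a <= x); rewrite ?maxey ?maxye.
- by case: (x <= b); rewrite ?maxey ?maxye.
Qed.

Let phi (s : R) := z s - z 0.

Let phiD s t : 0 <= s -> 0 <= t -> phi (s + t) = phi s + phi t.
Proof.
move=> s0 t0; have st : s <= s + t by rewrite lerDl.
have := Z_split (@convex_lipschitz0 R) s0 st.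
rewrite !Z_restr0 !subr0 subrr [in z (_ - _)]addrAC subrr add0r /phi; lra.
Qed.

Let phiMn n s : 0 <= s -> phi (n%:R * s) = n%:R * phi s.
Proof.
move=> s0; elim: n => [|n IH]; first by rewrite !mul0r /phi subrr.
by rewrite -natr1 !mulrDl !mul1r phiD ?mulr_ge0// IH.
Qed.

(** Cauchy's equation with continuity at 0: [s] is a multiple of 1/(k+1) plus a remainder [r k] in
    [0, 1/(k+1)]. Additivity is exact on the multiple, so [phi (r k)] differs from
    [phi s - s * phi 1] by [r k * phi 1]; both [phi (r k)] and [r k] tend to 0. *)
Let phi_linear s : 0 <= s -> phi s = s * phi 1.
Proof.
move=> s0.
pose m k := Num.truncn (s * k.+1%:R); pose r k := s - (m k)%:R / k.+1%:R.
have rh k : 0 <= r k <= harmonic k.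
  have := truncn_itv (mulr_ge0 s0 (ler0n R k.+1)).
  rewrite -/(m k) /harmonic/= => /andP[h1 h2].
  rewrite /r subr_ge0 ler_pdivrMr// h1 /= lerBlDr -[X in X + _]mul1r -mulrDl.
  by rewrite ler_pdivlMr// addrC natr1 ltW.
have r0 : r @ \oo --> 0.
  apply: (squeeze_cvgr _ (cvg_cst 0) cvg_harmonic).
  by apply: nearW => k; exact: rh.
have phi_r k : phi (r k) = phi s - s * phi 1 + r k * phi 1.
  have /andP[rk0 _] := rh k.
  have i0 : 0 <= k.+1%:R^-1 :> R by rewrite invr_ge0.
  have := phiD (mulr_ge0 (ler0n R (m k)) i0) rk0.
  have -> : (m k)%:R * k.+1%:R^-1 + r k = s by rewrite /r addrC subrK.
  have := phiMn k.+1 i0; rewrite mulfV ?pnatr_eq0// => phi1.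
  have phiV : phi k.+1%:R^-1 = k.+1%:R^-1 * phi 1.
    by rewrite phi1 mulrA mulVf ?pnatr_eq0// mul1r.
  rewrite phiMn// phiV /r => ->; ring.
have phi_r0 : phi \o r @ \oo --> 0.
  rewrite -(subrr (z 0)); apply: cvgB; last exact: cvg_cst.
  exact: Zc (tau_cvg_shrinking_itv r0).
have phi_rl : phi \o r @ \oo --> phi s - s * phi 1 + 0 * phi 1.
  rewrite (_ : _ \o _ = fun k => phi s - s * phi 1 + r k * phi 1).
    by apply: cvgD; [exact: cvg_cst|apply: cvgM => //; exact: cvg_cst].
  by apply/funext => k; exact: phi_r.
apply/eqP; rewrite -subr_eq0 -[X in X == _]addr0 -[X in _ + X](mul0r (phi 1)).
apply/eqP.
rewrite -(cvg_lim _ phi_rl)//; exact: cvg_lim phi_r0.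
Qed.

Lemma Z_affine : exists c0 c1 : R,
  forall L m c (fL : convex_lipschitz L (fun x => m * x + c)) a b (ab : a <= b),
    Z (restr fL ab) = c0 + c1 * (b - a).
Proof.
exists (z 0), (phi 1) => L m c fL a b ab; rewrite Z_restr_affine.
by rewrite [phi 1 * _]mulrC -phi_linear ?subr_ge0// [RHS]addrC subrK.
Qed.

End functional_on_affine_functions.

(** * Chord interpolants on uniform meshes and their tau-convergence *)

Section piecewise_affine_interpolation.
Context {R : realType}.
Context (u : conv_ld R) (a b L : R).
Context (ab : a < b) (domE : dom u = `[a, b]%classic) (L0 : 0 < L).
Context (uL : lipschitz_int_dom L u).
Implicit Types (p q x : R) (n i j : nat).

Let f x := fine (u x).

Let domP x : dom u x <-> a <= x <= b.
Proof. by rewrite domE /= in_itv. Qed.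

Let fL x y : dom u x -> dom u y -> `|f x - f y| <= L * `|x - y|.
Proof. exact: dom_lipschitz (ltW L0) uL x y. Qed.

Definition slope p q := (f q - f p) / (q - p).
Definition chord p q x := slope p q * x + (f p - slope p q * p).

Lemma chord_l p q : chord p q p = f p.
Proof. by rewrite /chord; ring. Qed.

Lemma chord_r p q : p < q -> chord p q q = f q.
Proof. by move=> pq; rewrite /chord /slope; field; rewrite subr_eq0 gt_eqF. Qed.

Lemma chordE p q x : p < q ->
  (q - p) * chord p q x = (q - x) * f p + (x - p) * f q.
Proof. by move=> pq; rewrite /chord /slope; field; rewrite subr_eq0 gt_eqF. Qed.

Lemma chord_convex_lipschitz p q : p < q -> dom u p -> dom u q ->
  convex_lipschitz L (chord p q).
Proof.
move=> pq up uq; apply: convex_lipschitz_affine => //.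
have qp : 0 < q - p by rewrite subr_gt0.
rewrite /slope normrM normfV (gtr0_norm qp) ler_pdivrMr//.
by have := fL uq up; rewrite (gtr0_norm qp).
Qed.

Lemma chord_ge p q x : p < q -> p <= x <= q -> dom u p -> dom u q ->
  f x <= chord p q x.
Proof.
move=> pq pxq up uq; rewrite -(@ler_pM2l _ (q - p)) ?subr_gt0// chordE//.
by have [] := conv_ld_chord pxq up uq.
Qed.

(** Here [x] is an outer point, so the convexity inequality is read at whichever of [p] and [q] lies
    between [x] and the other. *)
Lemma chord_le p q x : p < q -> dom u p -> dom u q -> dom u x ->
  x <= p \/ q <= x -> chord p q x <= f x.
Proof.
move=> pq up uq ux xpq; rewrite -(@ler_pM2l _ (q - p)) ?subr_gt0// chordE//.
rewrite /f; case: xpq => [xp|qx].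
  have xpq : x <= p <= q by rewrite xp ltW.
  by have [_] := conv_ld_chord xpq ux uq; lra.
have pqx : p <= q <= x by rewrite qx ltW.
by have [_] := conv_ld_chord pqx up ux; lra.
Qed.

Definition mesh n i : R := a + i%:R * ((b - a) / n.+1%:R).

Let h0 n : 0 < (b - a) / n.+1%:R.
Proof. by rewrite divr_gt0// subr_gt0. Qed.

Lemma mesh0 n : mesh n 0 = a.
Proof. by rewrite /mesh mul0r addr0. Qed.

Lemma meshN n : mesh n n.+1 = b.
Proof. by rewrite /mesh mulrC divfK ?pnatr_eq0// addrC subrK. Qed.

Lemma meshS n i : mesh n i.+1 = mesh n i + (b - a) / n.+1%:R.
Proof. by rewrite /mesh -natr1 mulrDl mul1r addrA. Qed.

Lemma le_mesh n i j : (i <= j)%N -> mesh n i <= mesh n j.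
Proof. by move=> ij; rewrite lerD2l ler_wpM2r ?ler_nat// ltW. Qed.

Lemma lt_meshS n i : mesh n i < mesh n i.+1.
Proof. by rewrite meshS ltrDl. Qed.

Lemma mesh_dom n i : (i <= n.+1)%N -> dom u (mesh n i).
Proof.
by move=> ?; apply/domP; rewrite -{1}(mesh0 n) -(meshN n) !le_mesh.
Qed.

Lemma mesh_cover n j x : (0 < j)%N -> a <= x <= mesh n j ->
  exists2 i, (i < j)%N & mesh n i <= x <= mesh n i.+1.
Proof.
elim: j => // j IH _ /andP[ax xj].
have [j0|j0] := posnP j; first by exists 0%N; rewrite ?mesh0 ?ax -?j0.
have [xj'|xj'] := leP x (mesh n j).
  have [|i ij xi] := IH j0; first by rewrite ax.
  by exists i => //; rewrite (ltn_trans ij).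
by exists j => //; rewrite (ltW xj') xj.
Qed.

(* By convexity each chord line lies below u outside its own mesh cell, so the
   maximum of the chord lines is the piecewise affine interpolant of u. *)
Definition interpolant n x :=
  \big[Num.max/chord (mesh n 0) (mesh n 1) x]_(i < n.+1)
    chord (mesh n i) (mesh n i.+1) x.

Lemma interpolant_convex_lipschitz n : convex_lipschitz L (interpolant n).
Proof.
apply: (@convex_lipschitz_bigmax _ n L
  (fun i => chord (mesh n i) (mesh n i.+1))) => i ?.
by apply: chord_convex_lipschitz; rewrite ?lt_meshS//; apply: mesh_dom => //;
  exact: leqW.
Qed.

Lemma interpolantE n j x : (j <= n)%N -> mesh n j <= x <= mesh n j.+1 ->
  interpolant n x = chord (mesh n j) (mesh n j.+1) x.
Proof.
move=> jn xj.
have le_j i : (i <= n)%N ->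
    chord (mesh n i) (mesh n i.+1) x <= chord (mesh n j) (mesh n j.+1) x.
  move=> in_; have dm k : (k <= n)%N -> dom u (mesh n k) /\ dom u (mesh n k.+1).
    by move=> kn; split; apply: mesh_dom => //; exact: leqW.
  have [[iu iu'] [ju ju']] := (dm i in_, dm j jn).
  (* At both ends of cell [j] its own chord equals [u], while every chord is at most [u] at mesh
     points, none being interior to its cell. *)
  apply: (affine_le_between xj); rewrite -!/(chord _ _ _).
    rewrite chord_l; apply: chord_le => //; first exact: lt_meshS.
    by have [?|?] := leqP j i; [left|right]; exact: le_mesh.
  rewrite [leRHS]chord_r ?lt_meshS//.
  apply: chord_le => //; first exact: lt_meshS.
  by have [?|?] := ltnP j i; [left|right]; exact: le_mesh.
apply/le_anti/andP; split.
  by apply: bigmax_le => [|i _]; [exact: le_j|exact: le_j (leq_ord i)].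
have jn' : (j < n.+1)%N by [].
exact: (le_bigmax _ (fun i : 'I_n.+1 => chord (mesh n i) (mesh n i.+1) x)
  (Ordinal jn')).
Qed.

(** The chord and [u] agree at the left end of the cell, and each varies by at most L (b - a)/(n+1)
    across it; this accounts for the factor 2. *)
Lemma interpolant_bounds n x : a <= x <= b ->
  f x <= interpolant n x <= f x + 2 * L * (b - a) * harmonic n.
Proof.
move=> xab.
have xN : a <= x <= mesh n n.+1 by rewrite meshN.
have [j jn xj] := mesh_cover (ltn0Sn n) xN.
rewrite (interpolantE (jn : (j <= n)%N) xj).
have uj : dom u (mesh n j) by apply: mesh_dom; exact: ltnW.
have uj' : dom u (mesh n j.+1) by exact: mesh_dom.
rewrite chord_ge ?lt_meshS//=.
have [_ _ /(_ x (mesh n j))] := chord_convex_lipschitz (lt_meshS n j) uj uj'.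
rewrite chord_l.
have xu : dom u x by apply/domP.
have := fL uj xu; rewrite ler_distl => /andP[_].
rewrite (distrC (mesh n j)).
have : L * `|x - mesh n j| <= L * ((b - a) / n.+1%:R).
  move: xj; rewrite meshS => /andP[jx xj].
  by rewrite ler_pM2l// ger0_norm ?subr_ge0// lerBlDl.
rewrite /harmonic/= -[_ * (b - a) / _]mulrA -mulrA.
by move: (L * ((b - a) / _)) (L * `|_|) (f _) => A B C; lra.
Qed.

(** The interpolants lie above [u], so lower semicontinuity of [u] gives the liminf inequality;
    pointwise convergence makes constant sequences recovery sequences. *)
Lemma tau_cvg_interpolant :
  tau_cvg (fun n => restr (interpolant_convex_lipschitz n) (ltW ab)) u.
Proof.
have [[_ _ ulsc _] _ _] := conv_ldP u.
have uNy x : ~~ (a <= x <= b) -> u x = +oo%E.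
  move=> xab; apply/eqP; rewrite -leye_eq leNgt.
  by apply: contra xab => xu; exact/domP.
have uE x : a <= x <= b -> u x = (f x)%:E.
  by move=> xab; rewrite /f conv_ld_fineK//; exact/domP.
split.
- move=> x x_ x_x; apply: le_limn_einf => c /ulsc[V nV uV].
  near=> n.
  have Vn : V (x_ n) by near: n; exact: x_x.
  apply/ltW/(lt_le_trans (uV _ Vn)); rewrite /= /itv_fun; case: ifPn => xab.
    by rewrite uE// lee_fin; have /andP[] := interpolant_bounds n xab.
  by rewrite leey.
- move=> x; exists (fun=> x); first exact: cvg_cst.
  rewrite /= /itv_fun; have [xab|xab] := boolP (a <= x <= b); last first.
    by rewrite uNy//; exact: cvg_cst.
  rewrite uE//; apply: cvg_EFin; first exact: nearW.
  apply: (@squeeze_cvgr _ _ _ _ (fun=> f x)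
    (fun n => f x + 2 * L * (b - a) * harmonic n)).
  + by apply: nearW => n /=; exact: interpolant_bounds.
  + exact: cvg_cst.
  + rewrite -[X in _ --> X]addr0 -[X in _ --> f x + X](mulr0 (2 * L * (b - a))).
    by apply: cvgD; [exact: cvg_cst|apply: cvgMr; exact: cvg_harmonic].
- by exists L => // n; apply: itv_fun_lipschitz;
  exact: interpolant_convex_lipschitz.
Unshelve. all: by end_near. Qed.

Lemma interpolant_affine (Z : conv_ld R -> R) (c0 c1 : R) n : valuation Z ->
  (forall L m c (gL : convex_lipschitz L (fun x => m * x + c)) p q
    (pq : p <= q), Z (restr gL pq) = c0 + c1 * (q - p)) ->
  Z (restr (interpolant_convex_lipschitz n) (ltW ab)) = c0 + c1 * (b - a).
Proof.
move=> Zv Zaff; set w := interpolant_convex_lipschitz n.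
(* On a single point the interpolant agrees with an affine function of slope 0. *)
have Zpoint p : Z (restr w (lexx p)) = c0.
  have cL : convex_lipschitz 1 (fun x => 0 * x + interpolant n p).
    by apply: convex_lipschitz_affine; rewrite ?normr0.
  rewrite (@eq_restr _ _ _ w _ _ cL _ _ _ (lexx p)).
    by rewrite Zaff subrr mulr0 addr0.
  by move=> x; rewrite -eq_le => /eqP ->; rewrite mul0r add0r.
(* [restr] carries a proof of [a <= q], so the right end is a variable tied to the mesh by an
   equation; this allows [q] to be [b] itself at the end. *)
suff Zmesh j : (j <= n.+1)%N -> forall q (aq : a <= q), q = mesh n j ->
    Z (restr w aq) = c0 + c1 * (q - a).
  by apply: (Zmesh n.+1) => //; rewrite meshN.
elim: j => [_ q aq|j IH jn q aq qE].
  rewrite mesh0 => qa; case: _ / (esym qa) in aq *.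
  by rewrite (bool_irrelevance aq (lexx a)) Zpoint subrr mulr0 addr0.
have aj : a <= mesh n j by rewrite -{1}(mesh0 n) le_mesh.
have jq : mesh n j <= q by rewrite qE ltW// lt_meshS.
have := Z_split Zv w aj jq; rewrite Zpoint (IH (ltnW jn) _ aj erefl).
rewrite (bool_irrelevance (le_trans aj jq) aq).
have cL : convex_lipschitz L (chord (mesh n j) (mesh n j.+1)).
  by apply: chord_convex_lipschitz; rewrite ?lt_meshS//; apply: mesh_dom => //;
    exact: ltnW.
rewrite (@eq_restr _ _ _ w _ _ cL _ _ _ jq) ?Zaff; first by lra.
by move=> x xj; rewrite (interpolantE (j := j))// -qE.
Qed.

End piecewise_affine_interpolation.

Theorem corollary3 (R : realType) (Z : conv_ld R -> R) :
  [/\ tau_continuous Z,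
      translation_invariant Z,
      dually_epi_translation_invariant Z &
      valuation Z] <->
  exists c0 c1 : R, forall u : conv_ld R, Z u = c0 + c1 * V1 (dom u).
Proof.
split; last first.
  move=> [c0 [c1 ZE]]; split.
  - move=> u_ u /V1_dom_tau_continuous cV.
    rewrite ZE (_ : (fun k => _) = fun k => c0 + c1 * V1 (dom (u_ k))).
      by apply: cvgD; [exact: cvg_cst|apply: cvgMr].
    by apply/funext => k.
  - by move=> u c; rewrite !ZE V1_dom_translate.
  - by split => [u l|u c]; rewrite !ZE dom_add_fin.
  - by move=> u v i s iE sE; rewrite !ZE; have := V1_dom_valuation iE sE; nra.
move=> [Zc Zt Zd Zv]; have [c0 [c1 Zaff]] := Z_affine Zc Zt Zd Zv.
exists c0, c1 => u; have [a [b [ab domE]]] := dom_itv u.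
(* Interpolation requires [a < b]; on a one-point domain [u] is already the restriction of a
   constant. *)
rewrite domE V1_itv//; move: ab; rewrite le_eqVlt => /predU1P[abE|ab].
  have cL : convex_lipschitz 1 (fun x => 0 * x + fine (u a)).
    by apply: convex_lipschitz_affine; rewrite ?normr0.
  rewrite -abE -(Zaff _ _ _ cL _ _ (lexx a)).
  congr Z; apply: conv_ld_ext => x /=.
  have domP y : dom u y <-> a <= y <= a by rewrite domE -abE /= in_itv.
  rewrite /itv_fun; case: ifPn => [|xa].
    rewrite -eq_le => /eqP <-; rewrite mul0r add0r conv_ld_fineK//.
    by apply/domP; rewrite lexx.
  by apply/eqP; rewrite -leye_eq leNgt; apply: contra xa => ?; exact/domP.
have [_ _ [L L0 uL]] := conv_ldP u.
(* All interpolants have the domain of [u], so [Z] is constant along them and continuity passes this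
   constant to [u]. *)
have := Zc _ _ (tau_cvg_interpolant ab domE L0 uL).
rewrite (_ : (fun k => _) = fun=> c0 + c1 * (b - a)).
  by move=> h; rewrite -(cvg_lim _ h)// lim_cst.
by apply/funext => n; exact: interpolant_affine Zv Zaff.
Qed.
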